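(* Two finite graphs $X$ and $Y$ are almost-isospectral if and only if they are homotopy-equivalent, i.e. if and only if they become isomorphic in $\mathrm{Ho}(\mathrm{Gph})$.
   Context: A graph is $X=(X_0,X_1,s,t)$ with a set $X_0$ of nodes, a set $X_1$ of arcs, and functions $s,t:X_1\to X_0$ (source, target); loops and multiple arcs are allowed. A graph morphism $f:X\to Y$ is a pair $f_0:X_0\to Y_0$, $f_1:X_1\to Y_1$ with $s f_1=f_0 s$, $t f_1=f_0 t$. This is the category $\mathrm{Gph}$. A graph is finite if it has finitely many nodes and arcs. For a finite graph $X$ with $n$ nodes and adjacency operator (matrix) $A$, the characteristic polynomial is $a(x)=\det(xI-A)$ and the reversed characteristic polynomial is $u^n a(u^{-1})=\det(I-uA)$. Two finite graphs are almost-isospectral if they have the same reversed characteristic polynomial. For $n>0$, the cycle graph $\mathbf{C}_n$ has $\mathbb{Z}/n$ as nodes and as arcs, with $s(i)=i+1$, $t(i)=i$; $C_n(X)$ is the set of graph morphisms $\mathbf{C}_n\to X$. A graph morphism $f$ is Acyclic when $C_n(f):C_n(X)\to C_n(Y)$ is bijective for all $n>0$. The Acyclic morphisms are the weak equivalences of the model structure on $\mathrm{Gph}$ whose fibrations are the Surjecting morphisms (for every node $x$, $f$ maps the arcs with source $x$ onto the arcs with source $f(x)$) and whose cofibrations are the morphisms having the left lifting property with respect to all Acyclic Surjecting morphisms. $\mathrm{Ho}(\mathrm{Gph})$ is the homotopy category of this model structure, i.e. the localization of $\mathrm{Gph}$ at the Acyclic morphisms. *)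

(* Defs.v *)
From HB Require Import structures.
From mathcomp Require Import all_boot all_order all_algebra.
From mathcomp Require Import boolp.

Set Implicit Arguments.
Unset Strict Implicit.
Unset Printing Implicit Defensive.

Import GRing.Theory.
Local Open Scope ring_scope.

Record category := Category {
  obj :> Type;
  hom : obj -> obj -> Type;
  idm : forall X, hom X X;
  cmp : forall X Y Z, hom Y Z -> hom X Y -> hom X Z;
  cmp_idl : forall X Y (f : hom X Y), cmp (idm Y) f = f;
  cmp_idr : forall X Y (f : hom X Y), cmp f (idm X) = f;
  cmpA : forall X Y Z T (h : hom Z T) (g : hom Y Z) (f : hom X Y),
    cmp h (cmp g f) = cmp (cmp h g) f }.

Arguments idm {c} X.

Definition is_inverse (C : category) (X Y : C) (f : hom X Y) (g : hom Y X) :=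
  cmp g f = idm X /\ cmp f g = idm Y.

Definition is_iso (C : category) (X Y : C) (f : hom X Y) :=
  exists g, is_inverse f g.

Definition isomorphic (C : category) (X Y : C) :=
  exists f : hom X Y, is_iso f.

Record functor (C D : category) := Functor {
  fobj :> C -> D;
  fmap : forall X Y, hom X Y -> hom (fobj X) (fobj Y);
  fmap_id : forall X, fmap (idm X) = idm (fobj X);
  fmap_cmp : forall X Y Z (g : hom Y Z) (f : hom X Y),
    fmap (cmp g f) = cmp (fmap g) (fmap f) }.

Section Localization.
Variables (C : category) (W : forall X Y : C, hom X Y -> Prop).

(* Formal composites of morphisms of C and of formal inverses of morphisms   *)
(* in W; the localization has these, up to the least congruence weq making   *)
(* Wgen functorial and Winv f inverse to Wgen f, as its morphisms.           *)
Inductive word : C -> C -> Type :=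
| Wgen X Y (f : hom X Y) : word X Y
| Winv X Y (f : hom X Y) (Wf : W f) : word Y X
| Wcat X Y Z (q : word Y Z) (p : word X Y) : word X Z.

Inductive weq : forall X Y, word X Y -> word X Y -> Prop :=
| weq_refl X Y (p : word X Y) : weq p p
| weq_sym X Y (p q : word X Y) : weq p q -> weq q p
| weq_trans X Y (p q r : word X Y) : weq p q -> weq q r -> weq p r
| weq_cat X Y Z (q q' : word Y Z) (p p' : word X Y) :
    weq q q' -> weq p p' -> weq (Wcat q p) (Wcat q' p')
| weq_idl X Y (p : word X Y) : weq (Wcat (Wgen (idm Y)) p) p
| weq_idr X Y (p : word X Y) : weq (Wcat p (Wgen (idm X))) p
| weq_catA X Y Z T (r : word Z T) (q : word Y Z) (p : word X Y) :
    weq (Wcat r (Wcat q p)) (Wcat (Wcat r q) p)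
| weq_gen X Y Z (g : hom Y Z) (f : hom X Y) :
    weq (Wgen (cmp g f)) (Wcat (Wgen g) (Wgen f))
| weq_invl X Y (f : hom X Y) (Wf : W f) :
    weq (Wcat (Winv Wf) (Wgen f)) (Wgen (idm X))
| weq_invr X Y (f : hom X Y) (Wf : W f) :
    weq (Wcat (Wgen f) (Winv Wf)) (Wgen (idm Y)).

Definition lhom (X Y : C) :=
  {P : word X Y -> Prop | exists p, P = weq p}.

Definition lclass X Y (p : word X Y) : lhom X Y :=
  exist _ (weq p) (ex_intro _ p erefl).

Definition lrepr X Y (P : lhom X Y) : word X Y := projT1 (cid (proj2_sig P)).

Lemma lclassP X Y (p q : word X Y) : lclass p = lclass q <-> weq p q.
Proof.
split=> [[->]|pq]; first exact: weq_refl.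
apply: eq_exist; apply/funext => r; apply/propext; split=> H.
  exact: weq_trans (weq_sym pq) H.
exact: weq_trans pq H.
Qed.

Lemma lreprK X Y (P : lhom X Y) : lclass (lrepr P) = P.
Proof.
by case: P => P eP; apply: eq_exist; rewrite /lrepr; case: cid => p /= ->.
Qed.

Lemma lclassK X Y (p : word X Y) : weq (lrepr (lclass p)) p.
Proof. by apply/lclassP; rewrite lreprK. Qed.

Definition lid X : lhom X X := lclass (Wgen (idm X)).

Definition lcmp X Y Z (Q : lhom Y Z) (P : lhom X Y) : lhom X Z :=
  lclass (Wcat (lrepr Q) (lrepr P)).

Lemma lcmpE X Y Z (q : word Y Z) (p : word X Y) :
  lcmp (lclass q) (lclass p) = lclass (Wcat q p).
Proof. by apply/lclassP; apply: weq_cat; apply: lclassK. Qed.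

Lemma lcmp_idl X Y (P : lhom X Y) : lcmp (lid Y) P = P.
Proof. by rewrite -[P]lreprK lcmpE; apply/lclassP/weq_idl. Qed.

Lemma lcmp_idr X Y (P : lhom X Y) : lcmp P (lid X) = P.
Proof. by rewrite -[P]lreprK lcmpE; apply/lclassP/weq_idr. Qed.

Lemma lcmpA X Y Z T (R : lhom Z T) (Q : lhom Y Z) (P : lhom X Y) :
  lcmp R (lcmp Q P) = lcmp (lcmp R Q) P.
Proof.
by rewrite -[P]lreprK -[Q]lreprK -[R]lreprK !lcmpE; apply/lclassP/weq_catA.
Qed.

Definition localization : category :=
  Category lcmp_idl lcmp_idr lcmpA.

Definition loc_map (X Y : C) (f : hom X Y) : @hom localization X Y :=
  lclass (Wgen f).

Lemma loc_map_cmp (X Y Z : C) (g : hom Y Z) (f : hom X Y) :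
  loc_map (cmp g f) = cmp (loc_map g) (loc_map f).
Proof. by rewrite /= lcmpE; apply/lclassP/weq_gen. Qed.

Definition loc_functor : functor C localization :=
  @Functor C localization (fun X => X) loc_map (fun=> erefl) loc_map_cmp.

Lemma loc_functor_iso (X Y : C) (f : hom X Y) : W f -> is_iso (fmap loc_functor f).
Proof.
move=> Wf; exists (lclass (Winv Wf)); split; rewrite /= lcmpE; apply/lclassP.
  exact: weq_invl.
exact: weq_invr.
Qed.

Section Universal.
Variables (D : category) (F : functor C D).
Hypothesis FW : forall X Y (f : hom X Y), W f -> is_iso (fmap F f).

Fixpoint weval X Y (p : word X Y) : hom (F X) (F Y) :=
  match p in word X Y return hom (F X) (F Y) with
  | Wgen _ _ f => fmap F f
  | Winv _ _ f Wf => projT1 (cid (FW Wf))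
  | Wcat _ _ _ q p => cmp (weval q) (weval p)
  end.

Lemma weval_eq X Y (p q : word X Y) : weq p q -> weval p = weval q.
Proof.
elim=> {X Y p q} //=.
- by move=> X Y p q r _ -> _ ->.
- by move=> X Y Z q q' p p' _ -> _ ->.
- by move=> X Y p; rewrite fmap_id cmp_idl.
- by move=> X Y p; rewrite fmap_id cmp_idr.
- by move=> *; rewrite cmpA.
- by move=> *; rewrite fmap_cmp.
- by move=> X Y f Wf; case: cid => g [/= -> _]; rewrite fmap_id.
- by move=> X Y f Wf; case: cid => g [/= _ ->]; rewrite fmap_id.
Qed.

(* As loc_functor is the identity on objects, a functor extending F along it *)
(* has the object part of F, and only its action on morphisms is in question. *)
Lemma localization_universal :
  exists! G : forall X Y : C, @hom localization X Y -> hom (F X) (F Y),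
  [/\ forall X, G X X (@idm localization X) = idm (F X),
      forall X Y Z (q : @hom localization Y Z) (p : @hom localization X Y),
        G X Z (cmp q p) = cmp (G Y Z q) (G X Y p) &
      forall X Y (f : hom X Y), G X Y (fmap loc_functor f) = fmap F f].
Proof.
pose G X Y (P : lhom X Y) := weval (lrepr P).
have GE X Y (p : word X Y) : G X Y (lclass p) = weval p.
  by apply: weval_eq; apply: lclassK.
exists G; split; first split=> [X|X Y Z q p|X Y f] /=; rewrite ?GE //=.
  by rewrite fmap_id.
move=> H [Hid Hcmp HF]; apply: functional_extensionality_dep => X.
apply: functional_extensionality_dep => Y; apply/funext => P.
rewrite -[P]lreprK GE; elim: (lrepr P) => {X Y P} [X Y f|X Y f Wf|X Y Z q IHq p IHp] /=.
- by rewrite -HF.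
- case: cid => g [/= gf fg].
  rewrite -[RHS]cmp_idr -fg -HF cmpA -Hcmp /= lcmpE.
  have /lclassP -> := weq_invl Wf.
  by have /= -> := Hid X; rewrite cmp_idl.
- by rewrite IHq IHp -Hcmp /= lcmpE.
Qed.

End Universal.
End Localization.

Record graph := Graph {
  node : Type;
  arc : Type;
  src : arc -> node;
  tgt : arc -> node }.

Record gmorph (X Y : graph) := GMorph {
  gnode : node X -> node Y;
  garc : arc X -> arc Y;
  gsrc : forall a, src (garc a) = gnode (src a);
  gtgt : forall a, tgt (garc a) = gnode (tgt a) }.

Definition gid (X : graph) : gmorph X X :=
  @GMorph X X id id (fun=> erefl) (fun=> erefl).

Definition gcmp (X Y Z : graph) (g : gmorph Y Z) (f : gmorph X Y) : gmorph X Z :=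
  @GMorph X Z (gnode g \o gnode f) (garc g \o garc f)
    (fun a => etrans (gsrc g (garc f a)) (congr1 (gnode g) (gsrc f a)))
    (fun a => etrans (gtgt g (garc f a)) (congr1 (gnode g) (gtgt f a))).

Lemma gmorph_eq (X Y : graph) (f g : gmorph X Y) :
  gnode f = gnode g -> garc f = garc g -> f = g.
Proof.
case: f g => [f0 f1 fs ft] [g0 g1 gs gt] /= e0 e1.
by case: _ / e0 in gs gt *; case: _ / e1 in gs gt *; congr GMorph; exact: Prop_irrelevance.
Qed.

Lemma gcmp_idl X Y (f : gmorph X Y) : gcmp (gid Y) f = f.
Proof. exact: gmorph_eq. Qed.

Lemma gcmp_idr X Y (f : gmorph X Y) : gcmp f (gid X) = f.
Proof. exact: gmorph_eq. Qed.

Lemma gcmpA X Y Z T (h : gmorph Z T) (g : gmorph Y Z) (f : gmorph X Y) :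
  gcmp h (gcmp g f) = gcmp (gcmp h g) f.
Proof. exact: gmorph_eq. Qed.

Definition Gph : category := Category gcmp_idl gcmp_idr gcmpA.

(* ordS i is i + 1 modulo n. *)
Definition cycle_graph (n : nat) : graph :=
  @Graph 'I_n 'I_n (fun i => ordS i) (fun i => i).

Definition acyclic (X Y : Gph) (f : hom X Y) : Prop :=
  forall n : nat, (0 < n)%N ->
    bijective (fun c : hom (cycle_graph n : Gph) X => cmp f c).

Definition Ho_Gph : category := localization acyclic.

Definition homotopy_equivalent (X Y : graph) : Prop :=
  @isomorphic Ho_Gph X Y.

Record fingraph := FinGraph {
  fnode : finType;
  farc : finType;
  fsrc : farc -> fnode;
  ftgt : farc -> fnode }.

Coercion graph_of_fingraph (X : fingraph) : graph :=
  Graph (@fsrc X) (@ftgt X).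

(* The nodes are numbered by enum_val; the (i, j) entry counts the arcs from *)
(* node i to node j.                                                         *)
Definition adjacency (X : fingraph) : 'M[int]_#|fnode X| :=
  \matrix_(i, j)
    #|[set a : farc X | (fsrc a == enum_val i) && (ftgt a == enum_val j)]|%:R.

(* det (I - u A), as a polynomial in u = 'X. *)
Definition rev_char_poly (X : fingraph) : {poly int} :=
  \det (1%:M - 'X *: map_mx polyC (adjacency X)).

Definition almost_isospectral (X Y : fingraph) : Prop :=
  rev_char_poly X = rev_char_poly Y.

(* Main.v *)
From mathcomp Require Import all_boot all_order all_algebra ring boolp.
Require Import Defs.

(* For a graph X let P(X) be the set of periodic sequences of arcs x_0, x_1, ...
   of X with s(x_i) = t(x_(i+1)), and let cX be the graph with P(X) as nodes and
   arcs, the shift as source and the identity as target; cX is a disjoint union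
   of cycle graphs. C_n(cX) and C_n(X) are both the set of points of P(X) fixed
   by the n-th power of the shift, so that the morphism cX -> X sending x to its
   arc x_0 is Acyclic. Since all points of P(X) are periodic, cX is determined
   up to isomorphism by the numbers of these fixed points, that is by the
   numbers |C_n(X)|, when they are finite. Conversely, the functors C_n factor
   through Ho(Gph), so that these numbers are homotopy invariants. For finite X,
   |C_n(X)| = tr(A^n), and by Newton's identities the sequence of these traces
   and det(I - uA) determine each other. *)

Set Implicit Arguments.
Unset Strict Implicit.
Unset Printing Implicit Defensive.

Import GRing.Theory Num.Theory.

(** * Maps all of whose points are periodic *)

Section PeriodicMap.
Variables (S : choiceType) (f : S -> S).
Hypothesis f_per : forall x, exists n, (0 < n) && (iter n f x == x).

Definition period x := ex_minn (f_per x).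

Lemma period_gt0 x : 0 < period x.
Proof. by rewrite /period; case: ex_minnP => n /andP[]. Qed.

Lemma iter_period x : iter (period x) f x = x.
Proof. by rewrite /period; case: ex_minnP => n /andP[_ /eqP]. Qed.

Lemma iter_mod_period n x : iter (n %% period x) f x = iter n f x.
Proof.
rewrite {2}(divn_eq n (period x)) addnC iterD.
congr iter; elim: (n %/ _) => // k IHk.
by rewrite mulSn iterD -IHk iter_period.
Qed.

Lemma iter_fix n x : (iter n f x == x) = (period x %| n).
Proof.
apply/eqP/idP => [fnx|/dvdnP[k ->]]; last by rewrite -iter_mod_period modnMl.
rewrite /dvdn -leqn0 leqNgt; apply/negP => gt0.
have: period x <= n %% period x; last by rewrite leqNgt ltn_pmod ?period_gt0.
rewrite {1}/period; case: ex_minnP => m _; apply.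
by rewrite gt0 iter_mod_period fnx eqxx.
Qed.

Lemma iter_inj_mod m n x : (iter m f x == iter n f x) = (m == n %[mod period x]).
Proof.
wlog le_mn : m n / m <= n.
  by move=> H; case: (leqP m n) => [|/ltnW] /H // {}H; rewrite eq_sym H eq_sym.
rewrite eq_sym [RHS]eq_sym eqn_mod_dvd // -iter_fix.
apply/eqP/eqP => [eq_mn|fx]; last by rewrite -{1}(subnK le_mn) addnC iterD fx.
(* As [k + m = m * period x], another [k] iterations undo [iter m f] at [x]: periodicity yields the
   injectivity that is used here. *)
pose k := m * (period x).-1.
have fk : iter k f (iter m f x) = x.
  rewrite -iterD /k -mulnSr prednK ?period_gt0 //.
  by apply/eqP; rewrite iter_fix dvdn_mull.
by rewrite -{1}fk -iterD addnC iterD -(iterD (n - m) m) subnK // eq_mn fk.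
Qed.

Lemma period_iter n x : period (iter n f x) = period x.
Proof.
have dvdE k : (period (iter n f x) %| k) = (period x %| k).
  by rewrite -iter_fix -iterD iter_inj_mod -{2}[n]add0n eqn_modDr mod0n.
by apply/eqP; rewrite eqn_dvd dvdE dvdnn -dvdE dvdnn.
Qed.

Definition in_orbit x y := `[< exists n, y = iter n f x >].

Lemma in_orbit_refl x : in_orbit x x.
Proof. by apply/asboolP; exists 0. Qed.

(** Going on from [iter n f x] leads back to [x] by periodicity, so forward orbits partition [S]. *)
Lemma in_orbit_iter n x : in_orbit (iter n f x) =1 in_orbit x.
Proof.
move=> y; apply/asboolP/asboolP => -[k ->].
  by exists (k + n); rewrite iterD.
exists (k + n * (period x).-1).
rewrite -iterD -addnA -mulnSr prednK ?period_gt0 //.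
by apply/eqP; rewrite iter_inj_mod addnC modnMDl.
Qed.

(** [choose] gives equal values on extensionally equal predicates, whichever point satisfying them
    it starts from; so all points of an orbit get the same representative. *)
Definition orbit_rep x := choose (in_orbit x) x.

Lemma orbit_rep_iter n x : orbit_rep (iter n f x) = orbit_rep x.
Proof.
rewrite /orbit_rep (eq_choose (in_orbit_iter n x)).
apply: choose_id (in_orbit_refl x).
by rewrite -(in_orbit_iter n) in_orbit_refl.
Qed.

Lemma orbit_repP x : exists n, x = iter n f (orbit_rep x).
Proof.
have /asboolP[n repE] := chooseP (in_orbit_refl x).
exists (n * (period x).-1); rewrite /orbit_rep repE -iterD.
rewrite -mulnSr prednK ?period_gt0 //.
by apply/esym/eqP; rewrite iter_fix dvdn_mull.
Qed.

Lemma orbit_rep_id x : orbit_rep (orbit_rep x) = orbit_rep x.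
Proof. by have [n {2}->] := orbit_repP x; rewrite orbit_rep_iter. Qed.

Lemma period_rep x : period (orbit_rep x) = period x.
Proof. by have [n {2}->] := orbit_repP x; rewrite period_iter. Qed.

(** * Counting fixed points of powers by orbit length *)

Variable fixpts : nat -> seq S.
Hypothesis fixptsP : forall n, 0 < n ->
  uniq (fixpts n) /\ fixpts n =i [pred x | iter n f x == x].

Definition exact_pts d := [seq x <- fixpts d | period x == d].

Lemma uniq_exact_pts d : 0 < d -> uniq (exact_pts d).
Proof. by case/fixptsP => Ud _; rewrite filter_uniq. Qed.

Lemma mem_exact_pts d x : 0 < d -> (x \in exact_pts d) = (period x == d).
Proof.
case/fixptsP => _ fixE; rewrite mem_filter fixE inE iter_fix.
by case: eqP => // ->; rewrite dvdnn.
Qed.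

(** Double counting: each point fixed by the [n]-th power has exactly one period, which divides
    [n]. *)
Lemma size_fixpts n : 0 < n ->
  size (fixpts n) = \sum_(d < n.+1 | d %| n) size (exact_pts d).
Proof.
move=> n_gt0; have [Un fixE] := fixptsP n_gt0.
transitivity (\sum_(x <- fixpts n) \sum_(d < n.+1) (period x == d)).
  rewrite -sum1_size; apply: eq_big_seq => x.
  rewrite fixE inE iter_fix => per_dvd.
  have per_lt : period x < n.+1 by rewrite ltnS dvdn_leq.
  rewrite (bigD1 (Ordinal per_lt)) //= eqxx big1 // => d.
  by rewrite -val_eqE /= eq_sym => /negPf ->.
rewrite exchange_big [RHS]big_mkcond; apply: eq_bigr => d _.
rewrite -(big_mkcond (fun x => period x == d)) sum1_count -size_filter.
case: ifPn => [d_dvd|d_ndvd].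
  have d_gt0 := dvdn_gt0 n_gt0 d_dvd.
  apply/perm_size/uniq_perm; rewrite ?uniq_exact_pts ?filter_uniq // => x.
  rewrite mem_exact_pts // mem_filter fixE inE iter_fix.
  by case: eqP => // ->.
apply/eqP; rewrite size_filter -leqn0 leqNgt -has_count; apply/hasPn => x.
rewrite fixE inE iter_fix; apply: contraTN => /eqP ->; exact: d_ndvd.
Qed.

Definition reps d := [seq x <- exact_pts d | orbit_rep x == x].

Lemma uniq_reps d : 0 < d -> uniq (reps d).
Proof. by move=> d0; rewrite filter_uniq // uniq_exact_pts. Qed.

Lemma mem_reps d x :
  0 < d -> (x \in reps d) = (orbit_rep x == x) && (period x == d).
Proof. by move=> d0; rewrite mem_filter mem_exact_pts. Qed.

(** An orbit of length [d] consists of the distinct points [iter i f r] with [i < d], where [r] is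
    its representative. *)
Lemma size_exact_pts d : 0 < d -> size (exact_pts d) = size (reps d) * d.
Proof.
move=> d_gt0; rewrite -[X in _ * X](size_iota 0 d).
rewrite -(size_allpairs (fun r i => iter i f r)).
apply/perm_size/uniq_perm; rewrite ?uniq_exact_pts //.
  apply: allpairs_uniq; rewrite ?uniq_reps ?iota_uniq // => -[r i] [s j].
  case/allpairsP => -[r' i'] /= [mem_r lt_i [-> ->]].
  case/allpairsP => -[s' j'] /= [mem_s lt_j [-> ->]] eq_rs.
  move: mem_r mem_s lt_i lt_j eq_rs.
  rewrite !mem_reps // !mem_iota !add0n /=.
  move=> /andP[/eqP rr /eqP pr] /andP[/eqP ss _] lt_i lt_j eq_rs.
  have rs : r' = s'.
    by rewrite -rr -ss -(orbit_rep_iter i') eq_rs orbit_rep_iter.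
  move: eq_rs; rewrite -rs => /eqP; rewrite iter_inj_mod pr !modn_small //.
  by move=> /eqP ->.
move=> x; rewrite mem_exact_pts //; apply/eqP/allpairsP => [px|[[r i] /= [+ _ ->]]].
  have [n xE] := orbit_repP x; exists (orbit_rep x, n %% d) => /=; split.
  - by rewrite mem_reps // orbit_rep_id period_rep px !eqxx.
  - by rewrite mem_iota ltn_mod.
  - by rewrite {1}xE -px -period_rep iter_mod_period.
by rewrite mem_reps // period_iter => /andP[_ /eqP].
Qed.

End PeriodicMap.

Lemma exists_index (T : eqType) (s : seq T) i :
  uniq s -> i < size s -> exists2 x, x \in s & index x s = i.
Proof.
case: s => // a s Us lt_i; exists (nth a (a :: s) i); first exact: mem_nth.
exact: index_uniq.
Qed.

(** * Matching the orbits of two periodic maps *)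

Section Matching.
Variables (S S' : choiceType) (f : S -> S) (g : S' -> S').
Hypothesis f_per : forall x, exists n, (0 < n) && (iter n f x == x).
Hypothesis g_per : forall x, exists n, (0 < n) && (iter n g x == x).
Variables (F : nat -> seq S) (G : nat -> seq S').
Hypothesis FP : forall n, 0 < n ->
  uniq (F n) /\ F n =i [pred x | iter n f x == x].
Hypothesis GP : forall n, 0 < n ->
  uniq (G n) /\ G n =i [pred x | iter n g x == x].

Local Notation repsf := (reps f_per F).
Local Notation repsg := (reps g_per G).

(* A relation and not a map, so that exchanging f and g yields the inverse. *)
Definition matched x y := exists d n r r',
  [/\ 0 < d, r \in repsf d, r' \in repsg d, index r (repsf d) = index r' (repsg d)
    & x = iter n f r /\ y = iter n g r'].

Lemma matched_step x y : matched x y -> matched (f x) (g y).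
Proof.
by case=> d [n] [r] [r'] [d0 mr mr' ie [-> ->]]; exists d, n.+1, r, r'.
Qed.

(** The point [x] determines its representative and period, hence the index and [r']. The exponents
    [n] and [m] agree modulo the period, which [r] and [r'] share. *)
Lemma matched_fun x y y' : matched x y -> matched x y' -> y = y'.
Proof.
case=> d [n] [r] [r'] [d0 mr mr' ie [-> ->]].
case=> e [m] [s] [s'] [e0 ms ms' ie' [eq_rs ->]].
move: (mr) (ms); rewrite !mem_reps // => /andP[/eqP rr /eqP pr] /andP[/eqP ss /eqP ps].
have rs : r = s.
  by rewrite -rr -ss -(orbit_rep_iter f_per n) eq_rs orbit_rep_iter.
have de : d = e by rewrite -pr -ps rs.
move: ie'; rewrite -de -rs ie; rewrite -de in ms' => ie'.
have <- : r' = s' by rewrite -[r'](nth_index r' mr') ie' nth_index.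
apply/eqP; rewrite iter_inj_mod; move: mr'; rewrite mem_reps // => /andP[_ /eqP ->].
by rewrite -pr -iter_inj_mod eq_rs rs.
Qed.

Hypothesis size_FG : forall n, 0 < n -> size (F n) = size (G n).

(** In the divisor sums for [d] the terms of all proper divisors agree by induction, which leaves
    the term of [d] itself. *)
Lemma size_exact_pts_eq d :
  0 < d -> size (exact_pts f_per F d) = size (exact_pts g_per G d).
Proof.
elim/ltn_ind: d => d IHd d_gt0; have := size_FG d_gt0.
rewrite (size_fixpts f_per FP) // (size_fixpts g_per GP) // big_mkcond /=.
rewrite [RHS in _ = RHS -> _]big_mkcond /= !big_ord_recr /= dvdnn.
under eq_bigr => k _.
  rewrite (_ : (if _ then _ else _) =
    (if (k : nat) %| d then size (exact_pts g_per G k) else 0)); first over.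
  by case: ifP => // /(dvdn_gt0 d_gt0) k_gt0; apply: IHd.
by move/addnI.
Qed.

(** Dividing the numbers of points of period [d] by [d] shows that both maps have equally many
    orbits of length [d], so every index on one side occurs on the other. *)
Lemma matched_total x : exists y, matched x y.
Proof.
pose d := period f_per x; have d0 : 0 < d := period_gt0 f_per x.
have mr : orbit_rep f x \in repsf d.
  by rewrite mem_reps // (orbit_rep_id f_per) period_rep !eqxx.
have [|r' mr' ie] := @exists_index _ (repsg d) (index (orbit_rep f x) (repsf d))
  (uniq_reps g_per GP d0).
  suff <- : size (repsf d) = size (repsg d) by rewrite index_mem.
  apply/eqP; rewrite -(eqn_pmul2r d0) -!size_exact_pts //.
  exact/eqP/size_exact_pts_eq.
have [n xE] := orbit_repP f_per x.
by exists (iter n g r'), d, n, (orbit_rep f x), r'.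
Qed.

End Matching.

(** The matching is total and functional in both directions, hence the graph of a bijection; it is
    compatible with one step of both maps. *)
Theorem periodic_map_conjugate (S S' : choiceType) (f : S -> S) (g : S' -> S')
    (F : nat -> seq S) (G : nat -> seq S') :
  (forall x, exists n, (0 < n) && (iter n f x == x)) ->
  (forall x, exists n, (0 < n) && (iter n g x == x)) ->
  (forall n, 0 < n -> uniq (F n) /\ F n =i [pred x | iter n f x == x]) ->
  (forall n, 0 < n -> uniq (G n) /\ G n =i [pred x | iter n g x == x]) ->
  (forall n, 0 < n -> size (F n) = size (G n)) ->
  exists2 phi : S -> S', bijective phi & forall x, phi (f x) = g (phi x).
Proof.
move=> f_per g_per FP GP sFG.
have sGF n : 0 < n -> size (G n) = size (F n) by move/sFG.
have [phi phiP] := choice (matched_total f_per g_per FP GP sFG).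
have [psi psiP] := choice (matched_total g_per f_per GP FP sGF).
have matched_sym x y : matched f_per g_per F G x y <-> matched g_per f_per G F y x.
  by split=> -[d] [n] [r] [r'] [d0 mr mr' ie [-> ->]]; exists d, n, r', r.
exists phi => [|x].
  exists psi => x.
    by apply: (matched_fun GP FP (psiP _)); apply/matched_sym.
  by apply: (matched_fun FP GP (phiP _)); apply/matched_sym.
exact: (matched_fun FP GP (phiP _) (matched_step (phiP _))).
Qed.

Local Open Scope ring_scope.

(** * Newton's identities for det (1 - u A) *)

Lemma deriv_prod (R : comNzRingType) (n : nat) (F : 'I_n -> {poly R}) :
  (\prod_i F i)^`() = \sum_i (F i)^`() * \prod_(j | j != i) F j.
Proof.
elim: n F => [|n IHn] F; first by rewrite !big_ord0 derivC.
rewrite !big_ord_recl derivM IHn; congr (_ * _ + _).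
  by rewrite [RHS]big_mkcond big_ord_recl eqxx /= mul1r.
rewrite mulr_sumr; apply: eq_bigr => i _; rewrite mulrCA; congr (_ * _).
by rewrite [RHS]big_mkcond big_ord_recl neq_lift [X in _ * X = _]big_mkcond.
Qed.

(* Jacobi's formula *)
Lemma deriv_det (R : comNzRingType) (n : nat) (M : 'M[{poly R}]_n) :
  (\det M)^`() = \tr (map_mx (@deriv R) M *m \adj M).
Proof.
(* [N i] is [M] with row [i] differentiated. The Leibniz formula turns the derivative into the sum
   of their determinants, each then expanded along row [i]. *)
pose N i := \matrix_(k, j) (if k == i then (M k j)^`() else M k j).
transitivity (\sum_i \det (N i)).
  rewrite /determinant linear_sum exchange_big /=; apply: eq_bigr => s _.
  have -> : (-1) ^+ perm.odd_perm s = ((-1) ^+ perm.odd_perm s)%:P :> {poly R}.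
    by rewrite rmorphXn rmorphN1.
  rewrite mul_polyC derivZ -mul_polyC deriv_prod mulr_sumr.
  apply: eq_bigr => i _; congr (_ * _).
  rewrite [RHS](bigD1 i) //= /N mxE eqxx; congr (_ * _).
  by apply: eq_bigr => j /negPf ji; rewrite mxE ji.
apply: eq_bigr => i _; rewrite (expand_det_row _ i) mxE.
apply: eq_bigr => j _; rewrite !mxE eqxx; congr (_ * (_ * \det _)).
by apply/matrixP => k l; rewrite !mxE eq_sym (negPf (neq_lift _ _)).
Qed.

Definition rev_char (R : comNzRingType) (n : nat) (A : 'M[R]_n) : {poly R} :=
  \det (1%:M - 'X *: map_mx polyC A).

Lemma rev_char_coef0 (R : comNzRingType) (n : nat) (A : 'M[R]_n) :
  (rev_char A)`_0 = 1.
Proof.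
rewrite -horner_coef0 -horner_evalE -det_map_mx.
rewrite -[RHS](det1 R n); congr determinant; apply/matrixP => i j.
by rewrite !mxE /= horner_evalE hornerD hornerN hornerM hornerX mul0r subr0
  -polyC_natr hornerC.
Qed.

(** With [D] the adjugate of [1 - uA], Jacobi's formula reads [q' = - tr (A D)]. Comparing
    coefficients in [(1 - uA) D = q] gives a recursion for those of [D]. *)
Lemma rev_char_coefS (R : comNzRingType) (n : nat) (A : 'M[R]_n) k :
  (rev_char A)`_k.+1 *+ k.+1 =
  - \sum_(j < k.+1) (rev_char A)`_(k - j) * \tr (A ^+ j.+1).
Proof.
set q := rev_char A.
pose M := 1%:M - 'X *: map_mx polyC A.
(* [D] is made opaque so that [mxE] does not expand the adjugate into cofactors. *)
have [D eD] : exists D, D = \adj M by exists (\adj M).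
pose G k := map_mx (coefp k) (D).
have MG : D = q%:M + 'X *: (map_mx polyC A *m D).
  by rewrite -mul_mx_adj -eD mulmxBl mul1mx -scalemxAl addrNK.
have coefAG l : map_mx (coefp l) (map_mx polyC A *m D) = A *m G l.
  apply/matrixP => i j; rewrite !mxE /= coef_sum; apply: eq_bigr => m _.
  by rewrite !mxE coefCM.
(* Unfolds the recursion [G (l + 1) = q_(l+1) + A G l], where [G 0 = q_0]. *)
have GE l : G l = \sum_(j < l.+1) q`_(l - j) *: A ^+ j.
  elim: l => [|l IHl].
    rewrite big_ord1 subnn expr0; apply/matrixP => i j.
    by rewrite !mxE /= {1}MG !mxE coefD coefMn coefXM addr0 mulr_natr.
  rewrite big_ord_recl subn0 expr0.
  rewrite (eq_bigr (fun j : 'I_l.+1 => A *m (q`_(l - j) *: A ^+ j))); last first.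
    by move=> j _; rewrite -scalemxAr exprS.
  rewrite -mulmx_sumr -IHl -coefAG; apply/matrixP => i j.
  by rewrite !mxE /= {1}MG !mxE coefD coefMn coefXM mulr_natr.
rewrite -coef_deriv deriv_det -/M -eD.
have -> : map_mx (@deriv R) M = - map_mx polyC A.
  by apply/matrixP => i j; rewrite !mxE !derivE; ring.
rewrite mulNmx raddfN coefN; congr (- _).
transitivity (\tr (A *m G k)).
  rewrite -coefAG /mxtrace coef_sum; apply: eq_bigr => i _.
  by rewrite [RHS]mxE.
rewrite GE mulmx_sumr raddf_sum; apply: eq_bigr => j _.
by rewrite /= -scalemxAr mxtraceZ exprS.
Qed.

(** In each identity the new trace has coefficient [q_0 = 1] and the new coefficient of [q] a factor
    [k + 1], which cancels in [int]. Powers start at 1, as the trace of the power 0 is the size of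
    the matrix, which may differ. *)
Lemma rev_char_eq_trace m n (A : 'M[int]_m) (B : 'M[int]_n) :
  rev_char A = rev_char B <-> forall k, \tr (A ^+ k.+1) = \tr (B ^+ k.+1).
Proof.
split=> [AB k|AB].
  elim/ltn_ind: k => k IHk.
  have := rev_char_coefS A k; rewrite AB rev_char_coefS => /oppr_inj.
  rewrite !big_ord_recr subnn rev_char_coef0 !mul1r /= => /esym.
  rewrite (eq_bigr (fun j : 'I_k => (rev_char B)`_(k - j) * \tr (B ^+ j.+1))).
    exact: addrI.
  by move=> j _; rewrite IHk.
apply/polyP => k; elim/ltn_ind: k => -[|k] IHk; first by rewrite !rev_char_coef0.
apply: (@pmulrnI _ k.+1) => //=; rewrite !rev_char_coefS; congr (- _).
apply: eq_bigr => j _; rewrite AB IHk //.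
by rewrite ltnS leq_subr.
Qed.

(** * Counting closed walks *)

Lemma big_tuple_cons (R : nmodType) (T : finType) n (F : n.+1.-tuple T -> R) :
  \sum_p F p = \sum_z \sum_(p : n.-tuple T) F [tuple of z :: p].
Proof.
rewrite pair_big /= (reindex (fun zp : T * n.-tuple T => [tuple of zp.1 :: zp.2])) //=.
exists (fun p : n.+1.-tuple T => (thead p, [tuple of behead p])) => [[z p]|p] _.
  by congr pair; apply: val_inj.
by rewrite /= [RHS]tuple_eta; apply: val_inj.
Qed.

Definition rel_mx (T : finType) (e : rel T) : 'M[int]_#|T| :=
  \matrix_(i, j) (e (enum_val i) (enum_val j))%:R.

Lemma rel_mxX (T : finType) (e : rel T) n i j :
  (rel_mx e ^+ n) i j =
  \sum_(p : n.-tuple T)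
    (path e (enum_val i) p && (last (enum_val i) p == enum_val j))%:R.
Proof.
elim: n i => [|n IHn] i.
  rewrite expr0 mxE (big_pred1 [tuple]) => [|p]; last exact/esym/eqP/tuple0.
  by rewrite /= (inj_eq enum_val_inj).
rewrite exprS mxE big_tuple_cons [RHS](reindex_onto enum_val enum_rank) /=; last first.
  by move=> x _; rewrite enum_rankK.
apply: eq_big => [k|k _]; first by rewrite enum_valK eqxx.
rewrite IHn mulr_sumr mxE; apply: eq_bigr => p _.
by rewrite -natrM mulnb andbA.
Qed.

Lemma mxtrace_rel_mxX (T : finType) (e : rel T) n :
  \tr (rel_mx e ^+ n.+1) = #|[set s : n.+1.-tuple T | cycle e s]|%:R.
Proof.
rewrite -sum1_card natr_sum big_mkcond big_tuple_cons /=.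
rewrite [RHS](reindex_onto enum_val enum_rank) /=; last first.
  by move=> x _; rewrite enum_rankK.
apply: eq_big => [k|k _]; first by rewrite enum_valK eqxx.
(* The last factor is the step by which [cycle] returns from the end of the path to its head. *)
rewrite exprSr mxE.
rewrite [LHS](eq_bigr _ (fun j _ => congr1 (fun z => z * _) (rel_mxX e n k j))).
rewrite [LHS](eq_bigr _ (fun j _ => mulr_suml _ _ _ _)).
rewrite exchange_big /=; apply: eq_bigr => p _.
rewrite inE /= rcons_path.
rewrite (bigD1 (enum_rank (last (enum_val k) p))) //= big1 => [|l].
  by rewrite mxE enum_rankK eqxx andbT addr0 -natrM mulnb; case: (_ && _).
rewrite eq_sym -(inj_eq enum_val_inj) enum_rankK => /negPf ->.
by rewrite andbF mul0r.
Qed.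

(** Puts [cycle] into the form of the incidences in [cycle_graph n]; the last index wraps round to
    0. *)
Lemma cycle_tnthP (T : eqType) (e : rel T) n (s : n.-tuple T) :
  reflect (forall i, e (tnth s i) (tnth s (ordS i))) (cycle e s).
Proof.
case: n s => [|n] s; first by rewrite tuple0; left; case.
case/tupleP: s => x p; apply: (iffP (pathP x)) => /= [H i|H i].
  rewrite !(tnth_nth x) /=; have := H i.
  rewrite size_rcons size_tuple ltn_ord => /(_ isT); rewrite -rcons_cons !nth_rcons /=
    !size_tuple ltn_ord.
  have [lt_i|lt_i|->] := ltngtP i n; last by rewrite modnn.
    by rewrite modn_small.
  by have := ltn_ord i; rewrite ltnS leqNgt lt_i.
rewrite size_rcons size_tuple => lt_i; have := H (Ordinal lt_i).
rewrite !(tnth_nth x) /= -rcons_cons !nth_rcons /= !size_tuple lt_i.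
have [lt_in|gt_in|->] := ltngtP i n; last by rewrite modnn.
  by rewrite modn_small.
by move: lt_i; rewrite ltnS leqNgt gt_in.
Qed.

(** Arcs are listed against their direction, as in the cycle graph, where [s(i) = i + 1] and
    [t(i) = i]. *)
Definition closed_walks (X : fingraph) n : {set n.-tuple (farc X)} :=
  [set s : n.-tuple (farc X) | cycle (fun a b => fsrc a == ftgt b) s].

(** Succession of arcs has matrix [S T], with [S] and [T] the incidence matrices of sources and
    targets, while [T S] is the transpose of the adjacency matrix. Powers of [S T] and [T S] have
    the same trace. *)
Lemma mxtrace_adjacencyX (X : fingraph) n :
  \tr (adjacency X ^+ n.+1) = #|closed_walks X n.+1|%:R.
Proof.
rewrite -mxtrace_rel_mxX.
pose S : 'M[int]_(#|farc X|, #|fnode X|) :=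
  \matrix_(i, j) (fsrc (enum_val i) == enum_val j)%:R.
pose T : 'M[int]_(#|fnode X|, #|farc X|) :=
  \matrix_(i, j) (ftgt (enum_val j) == enum_val i)%:R.
have -> : rel_mx (fun a b => fsrc a == ftgt b) = S *m T.
  apply/matrixP => i j; rewrite !mxE (bigD1 (enum_rank (fsrc (enum_val i)))) //=.
  rewrite !mxE enum_rankK eqxx mul1r big1 ?addr0 1?eq_sym // => k.
  rewrite eq_sym -(inj_eq enum_val_inj) enum_rankK !mxE => /negPf ->.
  by rewrite mul0r.
have AE : (adjacency X)^T = T *m S.
  apply/matrixP => i j; rewrite !mxE -sum1_card natr_sum big_mkcond.
  rewrite (reindex_onto enum_val enum_rank) /=; last first.
    by move=> x _; rewrite enum_rankK.
  apply: eq_big => [k|k _]; first by rewrite enum_valK eqxx.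
  by rewrite !mxE inE -natrM mulnb andbC; case: (_ && _).
have trX k : ((adjacency X)^T) ^+ k = ((adjacency X) ^+ k)^T.
  by elim: k => [|k IHk]; rewrite ?trmx1 // exprS IHk exprSr trmx_mul.
rewrite -mxtrace_tr -trX AE.
have -> : (S *m T) ^+ n.+1 = S *m (T *m S) ^+ n *m T.
  elim: n => [|n IHn]; first by rewrite expr1 expr0 mulmx1.
  by rewrite exprS IHn exprS -!mulmxE !mulmxA.
by rewrite mxtrace_mulC mulmxA mulmxE -exprS.
Qed.

(** * Periodic paths and the homotopy category *)

Lemma is_iso_cmp (C : category) (X Y Z : C) (g : hom Y Z) (f : hom X Y) :
  is_iso g -> is_iso f -> is_iso (cmp g f).
Proof.
move=> [g' [g'g gg']] [f' [f'f ff']]; exists (cmp f' g'); split.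
  by rewrite -cmpA [cmp g' _]cmpA g'g cmp_idl.
by rewrite -cmpA [cmp f _]cmpA ff' cmp_idl.
Qed.

Lemma is_iso_fmap (C D : category) (F : functor C D) (X Y : C) (f : hom X Y) :
  is_iso f -> is_iso (fmap F f).
Proof.
by move=> [g [gf fg]]; exists (fmap F g); split; rewrite -fmap_cmp ?gf ?fg fmap_id.
Qed.

Lemma is_iso_inverse (C : category) (X Y : C) (f : hom X Y) (g : hom Y X) :
  is_inverse f g -> is_iso g.
Proof. by case=> gf fg; exists f. Qed.

(* The image of C_n(-) : Gph -> Set. The sets C_n(X) are encoded by the graphs
   X because the category of all sets of their size is too large to be a
   [category]. *)
Definition cycle_sets (n : nat) : category :=
  @Category graph
    (fun X Y => gmorph (cycle_graph n) X -> gmorph (cycle_graph n) Y)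
    (fun X => id) (fun X Y Z g f => g \o f)
    (fun X Y f => erefl) (fun X Y f => erefl) (fun X Y Z T h g f => erefl).

Lemma gcmp_idm (Z X : graph) : gcmp (gid X) = id :> (gmorph Z X -> gmorph Z X).
Proof. by apply/funext => f; rewrite gcmp_idl. Qed.

Lemma gcmp_gcmp (Z X Y T : graph) (g : gmorph Y T) (f : gmorph X Y) :
  gcmp (gcmp g f) = gcmp g \o gcmp f :> (gmorph Z X -> gmorph Z T).
Proof. by apply/funext => h /=; rewrite gcmpA. Qed.

Definition cycle_functor n : functor Gph (cycle_sets n) :=
  @Functor Gph (cycle_sets n) id (fun X Y f => gcmp f)
    (@gcmp_idm _) (fun X Y Z => @gcmp_gcmp _ X Y Z).

(** [C_n] inverts Acyclic morphisms, so by the universal property it extends to the localization,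
    where it sends isomorphisms to bijections. *)
Lemma homotopy_equivalent_cycles (X Y : graph) n :
  homotopy_equivalent X Y -> (0 < n)%N ->
  exists f : gmorph (cycle_graph n) X -> gmorph (cycle_graph n) Y, bijective f.
Proof.
move=> [f [g [gf fg]]] n_gt0.
have FW (U V : Gph) (h : hom U V) : acyclic h -> is_iso (fmap (cycle_functor n) h).
  by move=> /(_ n n_gt0)[k hk kh]; exists k; split; apply/funext.
have [G [[Gid Gcmp _] _]] := localization_universal FW.
exists (G _ _ f); exists (G _ _ g) => c.
  by have := Gcmp _ _ _ g f; rewrite gf Gid => /(congr1 (@^~ c)) /esym.
by have := Gcmp _ _ _ f g; rewrite fg Gid => /(congr1 (@^~ c)) /esym.
Qed.

Lemma val_iter_ordS n k (i : 'I_n) : iter k (@ordS n) i = ((i + k) %% n)%N :> nat.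
Proof.
elim: k => [|k /= ->]; first by rewrite addn0 modn_small.
by rewrite -addn1 modnDml addn1 addnS.
Qed.

Lemma iter_ordS_id n (i : 'I_n) : iter n (@ordS n) i = i.
Proof. by apply: val_inj; rewrite /= val_iter_ordS modnDr modn_small. Qed.

(** * The graph of periodic paths and its projection *)

Section PeriodicPaths.
Variable X : graph.

Definition periodic_path_spec (x : nat -> arc X) : Prop :=
  (forall i, src (x i) = tgt (x i.+1)) /\
  (exists n, (0 < n)%N /\ forall i, x (i + n)%N = x i).

Definition periodic_path := {x : nat -> arc X | periodic_path_spec x}.

Lemma shift_subproof (x : periodic_path) :
  periodic_path_spec (fun i => sval x i.+1).
Proof.
case: x => x [xP [n [n_gt0 xn]]]; split=> [i|] /=; first exact: xP.
by exists n; split=> // i; rewrite -addSn xn.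
Qed.

Definition shift (x : periodic_path) : periodic_path :=
  exist _ _ (shift_subproof x).

Lemma iter_shiftE n x i : sval (iter n shift x) i = sval x (i + n)%N.
Proof. by elim: n i => [|n IHn] i /=; rewrite ?addn0 // IHn addSnnS. Qed.

Lemma periodic_path_inj (x y : periodic_path) : sval x =1 sval y -> x = y.
Proof.
by case: x y => [x xP] [y yP] /= xy; apply: eq_exist; apply/funext.
Qed.

(** [{classic _}] supplies the choice structure from which orbit representatives are taken. *)
Lemma shift_periodic (x : {classic periodic_path}) :
  exists n, (0 < n)%N && (iter n (shift : {classic periodic_path} -> _) x == x).
Proof.
have [_ [n [n_gt0 xn]]] := svalP x; exists n; rewrite n_gt0; apply/eqP.
by apply: periodic_path_inj => i; rewrite iter_shiftE.
Qed.

Definition path_graph : graph := @Graph periodic_path periodic_path shift id.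

Definition path_proj : gmorph path_graph X :=
  @GMorph path_graph X (fun x => tgt (sval x 0%N)) (fun x => sval x 0%N)
    (fun x => proj1 (svalP x) 0%N) (fun=> erefl).

Lemma unroll_subproof n (c : gmorph (cycle_graph n) X) (j : 'I_n) :
  periodic_path_spec (fun i => garc c (iter i (@ordS n) j)).
Proof.
split=> [i|]; first by rewrite gsrc gtgt.
exists n; split=> [|i]; first by case: n j {c} => [[]|].
by rewrite iterD iter_ordS_id.
Qed.

Definition unroll n (c : gmorph (cycle_graph n) X) (j : 'I_n) : periodic_path :=
  exist _ _ (unroll_subproof c j).

Lemma unroll_ordS n (c : gmorph (cycle_graph n) X) j :
  shift (unroll c j) = unroll c (ordS j).
Proof. by apply: periodic_path_inj => i; rewrite /= -iterSr. Qed.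

Definition lift_cycle n (c : gmorph (cycle_graph n) X) :
  gmorph (cycle_graph n) path_graph :=
  @GMorph (cycle_graph n) path_graph (unroll c) (unroll c)
    (unroll_ordS c) (fun=> erefl).

(** In a cycle of paths, the path at [j] shifts to the path at [j + 1]; hence the first arcs of the
    paths determine all of them, and unrolling is inverse to projecting. *)
Lemma acyclic_path_proj : @acyclic path_graph X path_proj.
Proof.
move=> n _; exists (@lift_cycle n) => c /=.
  have garcS j : shift (garc c j) = garc c (ordS j).
    by have := gsrc c j; have := gtgt c (ordS j) => /= -> ->.
  have garcE : unroll (gcmp path_proj c) = garc c.
    apply/funext => j; apply: periodic_path_inj => i /=.
    have -> : garc c (iter i (@ordS n) j) = iter i shift (garc c j).
      by elim: i => //= i <-.
    by rewrite iter_shiftE.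
  apply: gmorph_eq => //=; rewrite garcE; apply/funext => j.
  exact: (gtgt c j).
by apply: gmorph_eq => //=; apply/funext => j /=; rewrite gtgt.
Qed.

End PeriodicPaths.

(** * Closed walks as morphisms from cycle graphs and as fixed points of the shift *)

Section ClosedWalks.
Variables (X : fingraph) (n : nat).

Definition walk := {w : n.-tuple (farc X) | w \in closed_walks X n}.

Lemma walk_src (w : walk) i :
  fsrc (tnth (val w) i) = ftgt (tnth (val w) (ordS i)).
Proof. by case: w => w /=; rewrite inE => /cycle_tnthP /(_ i) /eqP. Qed.

Definition hom_of_walk (w : walk) : gmorph (cycle_graph n) X :=
  @GMorph (cycle_graph n) X (fun i => ftgt (tnth (val w) i)) (tnth (val w))
    (walk_src w) (fun=> erefl).

Lemma walk_of_hom_subproof (c : gmorph (cycle_graph n) X) :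
  [tuple garc c i | i < n] \in closed_walks X n.
Proof.
rewrite inE; apply/cycle_tnthP => i; rewrite !tnth_mktuple.
by have := gsrc c i; have := gtgt c (ordS i) => /= -> ->.
Qed.

Definition walk_of_hom (c : gmorph (cycle_graph n) X) : walk :=
  exist (fun w => w \in closed_walks X n) _ (walk_of_hom_subproof c).

Lemma walk_of_homK : cancel walk_of_hom hom_of_walk.
Proof.
move=> c; apply: gmorph_eq; apply/funext => i /=; rewrite tnth_mktuple //.
exact: (gtgt c i).
Qed.

Lemma hom_of_walkK : cancel hom_of_walk walk_of_hom.
Proof.
by move=> w; apply/val_inj/eq_from_tnth => i; rewrite /= tnth_mktuple.
Qed.

Lemma card_walk : #|{: walk}| = #|closed_walks X n|.
Proof. by rewrite card_sig; apply: eq_card => w; rewrite inE. Qed.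

End ClosedWalks.

(** A closed walk is repeated forever from its arc 0. The value at [n = 0] is a default, since
    ['I_0] has no starting index. *)
Definition shift_fixpts (X : fingraph) n : seq {classic periodic_path X} :=
  if n is m.+1 then [seq unroll (hom_of_walk w) ord0 | w : walk X m.+1]
  else [::].

Lemma size_shift_fixpts (X : fingraph) n : (0 < n)%N ->
  size (shift_fixpts X n) = #|closed_walks X n|.
Proof. by case: n => // n _; rewrite size_map -cardE card_walk. Qed.

Lemma shift_fixptsP (X : fingraph) n : (0 < n)%N ->
  uniq (shift_fixpts X n) /\
  shift_fixpts X n =i
    [pred x | iter n (@shift X : {classic periodic_path X} -> _) x == x].
Proof.
case: n => // n _.
have ord0E (i : 'I_n.+1) : iter i (@ordS n.+1) ord0 = i.
  by apply: val_inj; rewrite /= val_iter_ordS add0n modn_small.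
split=> [|x].
  rewrite map_inj_uniq ?enum_uniq // => v w vw.
  apply/val_inj/eq_from_tnth => i.
  by have /= := congr1 (fun x : periodic_path X => sval x (val i)) vw; rewrite ord0E.
rewrite inE; apply/imageP/eqP => [[w _ ->]|xn].
  by apply: periodic_path_inj => i; rewrite iter_shiftE /= iterD iter_ordS_id.
have xD i : sval x (i + n.+1)%N = sval x i by rewrite -iter_shiftE xn.
have x_mod i : sval x (i %% n.+1)%N = sval x i.
  rewrite [in RHS](divn_eq i n.+1); elim: (i %/ _)%N => // k IHk.
  by rewrite mulSn -addnA addnC xD.
(* The first [n + 1] arcs of a fixed path close up, because its arc [n + 1] is its arc 0. *)
have w_closed : [tuple sval x i | i < n.+1] \in closed_walks X n.+1.
  rewrite inE; apply/cycle_tnthP => i; rewrite !tnth_mktuple /= x_mod.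
  by apply/eqP; have [+ _] := svalP x; apply.
exists (exist (fun w => w \in closed_walks X n.+1) _ w_closed) => //.
apply: periodic_path_inj => i; rewrite /= tnth_mktuple val_iter_ordS add0n.
by rewrite x_mod.
Qed.

(** * Both equivalences compared through numbers of closed walks *)

Lemma almost_isospectralP (X Y : fingraph) :
  almost_isospectral X Y <->
  forall n, (0 < n)%N -> #|closed_walks X n| = #|closed_walks Y n|.
Proof.
split=> [/rev_char_eq_trace XY [|n] // _|XY].
  by have /eqP := XY n; rewrite !mxtrace_adjacencyX eqr_nat => /eqP.
apply/(rev_char_eq_trace (adjacency X) (adjacency Y)) => n.
by rewrite !mxtrace_adjacencyX XY.
Qed.

Theorem mainTheorem2 (X Y : fingraph) :
  almost_isospectral X Y <-> homotopy_equivalent X Y.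
Proof.
rewrite almost_isospectralP; split=> [XY|XY n n_gt0]; last first.
  have [f f_bij] := homotopy_equivalent_cycles XY n_gt0.
  rewrite -!card_walk.
  (* The bijection from [C_n(X)] to [C_n(Y)] is carried over to the finite types of walks. *)
  apply: (@bij_eq_card _ _ (@walk_of_hom Y n \o f \o @hom_of_walk X n)).
  apply: bij_comp; last by exists (@walk_of_hom X n);
    [exact: hom_of_walkK|exact: walk_of_homK].
  apply: bij_comp => //.
  by exists (@hom_of_walk Y n); [exact: walk_of_homK|exact: hom_of_walkK].
have [|phi phi_bij phi_shift] := periodic_map_conjugate (@shift_periodic X)
    (@shift_periodic Y) (@shift_fixptsP X) (@shift_fixptsP Y).
  by move=> n n_gt0; rewrite !size_shift_fixpts ?XY.
(* Nodes and arcs of a path graph coincide, with the shift as source, so an equivariant map of paths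
   serves as both components. *)
pose h : gmorph (path_graph X) (path_graph Y) :=
  @GMorph (path_graph X) (path_graph Y) phi phi
    (fun x => esym (phi_shift x)) (fun=> erefl).
have [psi phiK psiK] := phi_bij.
have psi_shift y : psi (shift y) = shift (psi y).
  by rewrite -[in LHS](psiK y) -phi_shift phiK.
pose k : gmorph (path_graph Y) (path_graph X) :=
  @GMorph (path_graph Y) (path_graph X) psi psi
    (fun x => esym (psi_shift x)) (fun=> erefl).
have h_iso : @is_iso Gph _ _ h.
  by exists k; split; apply: gmorph_eq; apply/funext => x /=; rewrite ?phiK ?psiK.
have proj_iso (Z : graph) :=
  @loc_functor_iso Gph acyclic _ _ _ (@acyclic_path_proj Z).
have [pX' pX'_inv] := proj_iso X.
(* The zigzag from [X] back to [path_graph X], across to [path_graph Y] and down to [Y]; [pX'] is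
   the formal inverse of the first projection. *)
exists (cmp (fmap (loc_functor acyclic) (path_proj Y : @hom Gph _ _))
  (cmp (fmap (loc_functor acyclic) (h : @hom Gph _ _)) pX')).
apply: is_iso_cmp (proj_iso Y) _; apply: is_iso_cmp; first exact: is_iso_fmap.
exact: is_iso_inverse pX'_inv.
Qed.
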